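(* Let $n\geq 1$ be an integer. The number of directed acyclic graphs on the labeled vertex set $\{1,2,\ldots,n\}$ equals the number of sequences $S_1,\ldots,S_{n-1}$ of subsets of $\{1,2,\ldots,n\}$ satisfying $$\Bigl|\bigcup_{i=1}^{k}S_i\Bigr|\leq k\quad\text{for every } 1\leq k\leq n-1.$$
   Context: A directed graph $G=(V,E)$ consists of a finite vertex set $V$ and an edge set $E\subseteq V\times V$. A directed acyclic graph (DAG) is a directed graph containing no directed cycles (in particular no loops). DAGs on $n$ labeled vertices are DAGs with vertex set $V=\{1,2,\ldots,n\}$, two of them being equal iff their edge sets are equal (they are not counted up to isomorphism). *)

(* Defs.v *)
From mathcomp Require Import all_boot.

Set Implicit Arguments.
Unset Strict Implicit.
Unset Printing Implicit Defensive.

(* A directed graph on V is identified with its edge set, so that graphs are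
   equal iff their edge sets are; (x, y) is the edge from x to y. *)
Definition digraph (V : finType) := {set V * V}.

Definition edge (V : finType) (E : digraph V) : rel V :=
  [rel x y | (x, y) \in E].

(* A directed cycle is a nonempty sequence of pairwise distinct vertices, each
   with an edge to the next and the last with an edge to the first; a loop is
   the case of one vertex.  Distinctness bounds the length by #|V|, so the
   quantification is finite; acyclicP and acyclic_closed_walkP remove the
   bound. *)
Definition acyclic (V : finType) (E : digraph V) : bool :=
  [forall k : 'I_#|V|, forall c : k.+1.-tuple V, ~~ ucycleb (edge E) c].

Lemma acyclicP (V : finType) (E : digraph V) :
  reflect (forall c : seq V, c != [::] -> ~ ucycle (edge E) c) (acyclic E).
Proof.
apply: (iffP idP) => [acE [//|x c] _ ucE | noc].
  have /andP[_ Uc] := ucE.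
  have ltc : size c < #|V| by have := max_card (mem (x :: c)); rewrite (card_uniqP Uc).
  move/forallP/(_ (Ordinal ltc))/forallP: acE => acE.
  by have /negP := acE (in_tuple (x :: c)); apply.
apply/forallP => k; apply/forallP => c; apply/negP => ucE.
by apply: (noc c); rewrite // -size_eq0 size_tuple.
Qed.

Lemma acyclic_closed_walkP (V : finType) (E : digraph V) :
  reflect (forall c : seq V, c != [::] -> ~ cycle (edge E) c) (acyclic E).
Proof.
apply: (iffP (acyclicP E)) => [noc [//|x c] _ | noc c c0 /andP[cE _]]; last first.
  exact: noc c0 cE.
rewrite /= rcons_path => /andP[xc lx].
case/shortenP: xc lx => p xp Up _ lx.
apply: (noc (x :: p)) => //.
by apply/andP; split; rewrite //= rcons_path xp.
Qed.

(* The entry of index i of S is the set S_(i+1): the union over the indices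
   i < k is S_1 :|: ... :|: S_k, for 1 <= k <= n - 1. *)
Definition small_unions (n : nat) (S : n.-1.-tuple {set 'I_n}) : bool :=
  [forall k : 'I_n,
     (0 < k) ==> (#|\bigcup_(i < n.-1 | i < k) tnth S i| <= k)].

(* Main.v *)
Require Import Defs.
From mathcomp Require Import all_boot.

(** Repeatedly deleting a sink w of an acyclic graph and recording its set of
    in-neighbours gives a sequence of sets, read backwards as S_(n-1), ..., S_1
    (the last vertex has no in-neighbours).  The sources of edges are exactly
    the elements of the union of the recorded sets, so w can be recovered as a
    fixed choice of an element outside this union.  Refining both counts by the
    union U, graphs and sequences therefore obey the same recursion: a sink w
    outside U is removed, its in-neighbours N are arbitrary subject to
    N :|: U' = U, and U' is the union for the remaining graph or sequence. *)

Set Implicit Arguments.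
Unset Strict Implicit.
Unset Printing Implicit Defensive.

(** * Counting by the value of the union *)

Section FiberCounting.
Variables (V T : finType) (P : pred T) (f : T -> {set V}).

Lemma card_fibers :
  #|[set x | P x]| = \sum_(U : {set V}) #|[set x | P x && (f x == U)]|.
Proof.
rewrite -sum1_card (partition_big f predT) //=; apply: eq_bigr => U _.
by rewrite -sum1_card; apply: eq_bigl => x; rewrite !inE.
Qed.

(** Both recursions leave a set [N] paired with a smaller object [x]. The number of such pairs
    depends on [x] only through the fibre sizes of [f], so the two recursions can be compared term
    by term. *)
Lemma card_union_pairs (U : {set V}) :
  #|[set p : {set V} * T | P p.2 && (p.1 :|: f p.2 == U)]|
  = \sum_(N : {set V}) \sum_(U' : {set V} | N :|: U' == U)
      #|[set x | P x && (f x == U')]|.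
Proof.
rewrite -sum1_card.
transitivity (\sum_(N : {set V}) \sum_(x | P x && (N :|: f x == U)) 1).
  by rewrite pair_big_dep /=; apply: eq_bigl => p; rewrite inE.
apply: eq_bigr => N _.
rewrite (partition_big f (fun U' => N :|: U' == U)) /=; last by move=> x /andP[].
apply: eq_bigr => U' /eqP NU'; rewrite -sum1_card; apply: eq_bigl => x.
rewrite inE; case: (f x =P U') => [->|_]; last by rewrite !andbF.
by rewrite NU' eqxx !andbT.
Qed.

End FiberCounting.

(** * Acyclic graphs and the removal of a sink *)

Section Graphs.
Variable V : finType.
Implicit Types (E : digraph V) (A U N : {set V}) (w : V).

Definition sources E : {set V} := [set e.1 | e in E].

Lemma sourcesP E x : reflect (exists y, (x, y) \in E) (x \in sources E).
Proof.
apply: (iffP imsetP) => [[[a b] abE ->]|[y xyE]]; first by exists b.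
by exists (x, y).
Qed.

(** The type [V] stays fixed while [A] shrinks, so that deleting a vertex involves no change of
    type. *)
Definition dag_on A E := acyclic E && (E \subset setX A A).

Lemma dag_on_edge A E x y : dag_on A E -> (x, y) \in E -> (x \in A) && (y \in A).
Proof. by case/andP=> _ /subsetP sE /sE; rewrite inE. Qed.

Lemma sources_dag_on A E : dag_on A E -> sources E \subset A.
Proof.
by move=> dE; apply/subsetP=> x /sourcesP[y] /(dag_on_edge dE) /andP[].
Qed.

Lemma acyclic_sub (E E' : digraph V) : E' \subset E -> acyclic E -> acyclic E'.
Proof.
move=> /subsetP sE /acyclic_closed_walkP acE.
apply/acyclic_closed_walkP=> c c0 cE'; apply: acE c0 _.
by apply: sub_cycle cE' => x y; apply: sE.
Qed.

(** If every vertex of [A] had an out-edge, following chosen out-edges from a point of [A] would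
    stay in [A] and eventually repeat, giving a closed walk. *)
Lemma acyclic_sources_neq E A : A != set0 -> dag_on A E -> sources E != A.
Proof.
case/set0Pn=> x0 x0A /andP[/acyclic_closed_walkP acE /subsetP sE].
apply/eqP=> srcE.
pose f x := odflt x [pick y | (x, y) \in E].
have fE x : x \in A -> (x, f x) \in E.
  rewrite /f -srcE => /sourcesP[y xyE].
  by case: pickP => [//|/(_ y)]; rewrite xyE.
have itA i : iter i f x0 \in A.
  by elim: i => //= i /fE /sE; rewrite inE => /andP[].
(* After [order f x0] steps the orbit of [x0] is back at its point of index [i], which therefore
   recurs after [order f x0 - i] steps. *)
have /trajectP[i ltin eqi] := looping_order f x0.
pose n := order f x0 - i.
have n0 : 0 < n by rewrite subn_gt0.
have itn : iter n f (iter i f x0) = iter i f x0.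
  by rewrite -iterD subnK // ltnW.
apply: (acE (traject f (iter i f x0) n)); first by rewrite -size_eq0 size_traject -lt0n.
case: n n0 itn => // m _ itn; rewrite /cycle /=.
(* Writing the closing vertex as the last iterate turns the closed walk into a single trajectory of
   [f]. *)
rewrite -[X in rcons _ X]itn iterSr -trajectSr.
have stepE : {in A &, subrel (frel f) (edge E)} by move=> x y /fE xE _ /eqP <-.
apply: (sub_in_path stepE) (fpath_traject _ _ _).
by apply/allP=> x; rewrite -trajectS => /trajectP[j _ ->]; rewrite -iterD; apply: itA.
Qed.

Definition add_sink w (p : {set V} * digraph V) : digraph V :=
  p.2 :|: setX p.1 [set w].

Lemma in_add_sink w p x y :
  ((x, y) \in add_sink w p) = ((x, y) \in p.2) || (x \in p.1) && (y == w).
Proof. by rewrite !inE. Qed.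

Lemma sources_add_sink w p : sources (add_sink w p) = p.1 :|: sources p.2.
Proof.
apply/setP=> x; rewrite inE; apply/sourcesP/orP=> [[y]|].
  rewrite in_add_sink => /orP[xyE|/andP[xN _]]; last by left.
  by right; apply/sourcesP; exists y.
case=> [xN|/sourcesP[y xyE]]; last by exists y; rewrite in_add_sink xyE.
by exists w; rewrite in_add_sink xN eqxx orbT.
Qed.

(** Every vertex of a closed walk is a source, so the walk avoids [w] and uses only edges of
    [p.2]. *)
Lemma acyclic_add_sink w p :
  w \notin sources (add_sink w p) -> acyclic p.2 -> acyclic (add_sink w p).
Proof.
move=> wE /acyclic_closed_walkP acE; apply/acyclic_closed_walkP=> c c0 cE.
apply: acE c0 _; apply: (@sub_in_cycle _ (predC1 w)) (cE) => [x y _|].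
  by move=> /negPf yw; rewrite /edge /= in_add_sink yw andbF orbF.
apply/allP=> x xc /=; apply: contraNneq wE => xw; rewrite -{1}xw.
by apply/sourcesP; exists (next c x); apply: next_cycle cE xc.
Qed.

(** Being outside [U], the vertex [w] is a sink of every graph in the fibre, so the same [w] can be
    deleted from all of them; [add_sink w] inverts the deletion. *)
Lemma card_remove_sink A U w : U \subset A -> w \in A :\: U ->
  #|[set E | dag_on A E && (sources E == U)]|
  = #|[set p : {set V} * digraph V |
        dag_on (A :\ w) p.2 && (p.1 :|: sources p.2 == U)]|.
Proof.
move=> sUA; rewrite inE => /andP[wU wA].
rewrite -(@card_in_imset _ _ (add_sink w)); last first.
  move=> [N1 E1] [N2 E2]; rewrite !inE /= => /andP[d1 _] /andP[d2 _] eqE.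
  have noin E x : dag_on (A :\ w) E -> ((x, w) \in E) = false.
    move=> dE; apply/negP=> /(dag_on_edge dE).
    by rewrite !inE eqxx andbF.
  have eqxy x y := congr1 (fun E : digraph V => (x, y) \in E) eqE.
  (* The edges into [w] give back the set, the other edges the graph. *)
  congr (_, _); apply/setP; first move=> x; last case=> x y.
    by have := eqxy x w; rewrite !in_add_sink /= !noin // eqxx !andbT.
  have := eqxy x y; rewrite !in_add_sink /=.
  by have [->|_] := eqVneq y w; rewrite ?noin // !andbF !orbF.
congr #|pred_of_set _|; apply/setP=> E; apply/idP/imsetP.
  rewrite inE => /andP[dE /eqP srcE].
  exists ([set x | (x, w) \in E], [set e in E | e.2 != w]); last first.
    apply/setP=> [[x y]]; rewrite in_add_sink !inE /=.
    by have [->|_] := eqVneq y w; rewrite ?andbT ?andbF ?orbF.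
  rewrite inE /=; apply/andP; split; first apply/andP; first split.
  - apply: acyclic_sub (proj1 (andP dE)).
    by apply/subsetP=> e; rewrite inE => /andP[].
  - apply/subsetP=> [[x y]]; rewrite !inE /= => /andP[xyE yw].
    have /andP[-> ->] := dag_on_edge dE xyE; rewrite yw !andbT.
    (* An edge out of [w] would put [w] into [U]. *)
    by apply: contraNneq wU => <-; rewrite -srcE; apply/sourcesP; exists y.
  - apply/eqP; rewrite -srcE -(sources_add_sink w (_, _)); congr sources.
    apply/setP=> [[x y]]; rewrite in_add_sink !inE /=.
    by have [->|_] := eqVneq y w; rewrite ?andbT ?andbF ?orbF.
case=> p; rewrite inE => /andP[dp /eqP eqU] ->.
rewrite inE sources_add_sink eqU eqxx andbT; apply/andP; split.
  by apply: acyclic_add_sink; rewrite ?sources_add_sink ?eqU //; case/andP: dp.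
apply/subsetP=> [[x y]]; rewrite in_add_sink inE /= => /orP[|/andP[xN /eqP->]].
  by case/(dag_on_edge dp)/andP; rewrite !inE => /andP[_ ->] /andP[].
by rewrite wA andbT (subsetP sUA) // -eqU inE xN.
Qed.

(** * Sequences of sets, and the common recursion *)

Definition seq_union (s : seq {set V}) : {set V} := \bigcup_(X <- s) X.

(* Sequences are stored with their last set first: the condition bears on the
   suffixes. *)
Fixpoint small_suffixes (s : seq {set V}) : bool :=
  if s is X :: s' then (#|seq_union s| <= size s) && small_suffixes s' else true.

Lemma small_suffixesP s :
  reflect (forall i, i < size s -> #|seq_union (drop i s)| <= size s - i)
          (small_suffixes s).
Proof.
elim: s => [|X s IHs] /=; first by left.
apply: (iffP andP) => [[leX /IHs small_s] [|i] //|small_s].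
  by rewrite ltnS subSS; apply: small_s.
by split; [apply: (small_s 0) | apply/IHs => i; apply: (small_s i.+1)].
Qed.

(** The bound on the whole sequence concerns [U] alone and holds by hypothesis, so only the bounds
    on the tail remain. *)
Lemma card_remove_head k U : #|U| <= k.+1 ->
  #|[set t : k.+1.-tuple {set V} | small_suffixes t && (seq_union t == U)]|
  = #|[set p : {set V} * k.-tuple {set V} |
        small_suffixes p.2 && (p.1 :|: seq_union p.2 == U)]|.
Proof.
move=> leU.
pose c (p : {set V} * k.-tuple {set V}) := [tuple of p.1 :: p.2].
rewrite -(@card_imset _ _ c); last first.
  move=> [N1 t1] [N2 t2] /(congr1 val) [/= -> eqt].
  by congr (_, _); apply: val_inj.
have cE p : seq_union (c p) = p.1 :|: seq_union p.2 by rewrite /seq_union big_cons.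
have cU p : seq_union (c p) = U -> small_suffixes (c p) = small_suffixes p.2.
  by move=> eqU; rewrite /= -[_ :: _]/(val (c p)) eqU size_tuple leU.
congr #|pred_of_set _|; apply/setP=> t; apply/idP/imsetP.
  rewrite inE => /andP[small_t /eqP eqU].
  have tE : t = c (thead t, [tuple of behead t]) by rewrite [LHS]tuple_eta.
  exists (thead t, [tuple of behead t]) => //.
  by rewrite inE -cU -?cE -tE ?eqU ?eqxx ?small_t.
case=> p; rewrite inE => /andP[small_p]; rewrite -cE => /eqP eqU ->.
by rewrite inE cU // small_p eqU eqxx.
Qed.

Lemma card_dag_on_sources k A U : #|A| = k.+1 -> U \subset A ->
  #|[set E | dag_on A E && (sources E == U)]|
  = #|[set t : k.-tuple {set V} | small_suffixes t && (seq_union t == U)]|.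
Proof.
elim: k A U => [|k IHk] A U cardA sUA.
  have A0 : A != set0 by rewrite -card_gt0 cardA.
  have dagE E : dag_on A E = (E == set0).
    apply/idP/eqP=> [dE|->]; last first.
      rewrite /dag_on sub0set andbT; apply/acyclic_closed_walkP=> [[//|x c]] _.
      by move/next_cycle/(_ (mem_head _ _)); rewrite /edge /= in_set0.
    have := sources_dag_on dE; rewrite subEproper (negPf (acyclic_sources_neq A0 dE)) /=.
    move/proper_card; rewrite cardA ltnS leqn0 cards_eq0 => /eqP src0.
    apply/setP=> [[x y]]; rewrite inE; apply/negP=> xyE.
    have : x \in sources E by apply/sourcesP; exists y.
    by rewrite src0 inE.
  have src0 : sources set0 = set0 by rewrite /sources imset0.
  (* Both sides are 1 for empty [U] (the edgeless graph, the empty sequence) and 0 otherwise. *)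
  have [->|U0] := eqVneq U set0.
    rewrite (_ : [set E | _] = [set set0]) ?cards1; last first.
      apply/setP=> E; rewrite !inE dagE.
      by case: (E =P set0) => [->|//]; rewrite src0 eqxx.
    rewrite (_ : [set t | _] = setT) ?cardsT ?card_tuple //.
    by apply/setP=> t; rewrite !inE tuple0 /= /seq_union big_nil eqxx.
  rewrite !eq_card0 // => [t|E]; rewrite !inE.
    by rewrite tuple0 /= /seq_union big_nil eq_sym (negPf U0).
  by rewrite dagE; case: (E =P set0) => [->|//]; rewrite src0 eq_sym (negPf U0).
(* For [U = A] both sides vanish: some vertex of [A] is not a source, and a union of [k.+1] sets
   bounded by [k.+1] cannot fill [A], which has [k.+2] elements. *)
move: (sUA); rewrite subEproper => /orP[/eqP->|].
  rewrite !eq_card0 // => [t|E]; rewrite !inE.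
    apply/negP=> /andP[/small_suffixesP/(_ 0)]; rewrite size_tuple drop0 => /(_ isT).
    by move=> leA /eqP eqA; move: leA; rewrite eqA cardA subn0 ltnn.
  apply/negP=> /andP[dE]; apply/negP; apply: acyclic_sources_neq dE.
  by rewrite -card_gt0 cardA.
move=> pUA; have leU : #|U| <= k.+1 by rewrite -ltnS -cardA proper_card.
have /properP[_ [w wA wU]] := pUA.
have wAU : w \in A :\: U by rewrite inE wU.
rewrite (card_remove_sink sUA wAU) (card_remove_head leU).
rewrite (card_union_pairs (dag_on (A :\ w))).
rewrite (card_union_pairs (fun t : k.-tuple _ => small_suffixes t)
  (fun t : k.-tuple _ => seq_union t)).
(* The induction hypothesis applies to [A :\ w] because [U'] is contained in [U] and so misses
   [w]. *)
apply: eq_bigr => N _; apply: eq_bigr => U' /eqP eqU; apply: IHk.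
  by move: cardA; rewrite (cardsD1 w) wA => -[].
have sU' : U' \subset U by rewrite -eqU subsetUr.
by rewrite subsetD1 (subset_trans sU' sUA); apply: contra wU; apply: (subsetP sU').
Qed.

Lemma card_acyclic k : #|V| = k.+1 ->
  #|[set E : digraph V | acyclic E]|
  = #|[set t : k.-tuple {set V} | small_suffixes t]|.
Proof.
rewrite -cardsT => cardV; rewrite (card_fibers _ sources).
rewrite (card_fibers _ (fun t : k.-tuple _ => seq_union t)).
apply: eq_bigr => U _; rewrite -(card_dag_on_sources cardV (subsetT U)).
apply: eq_card => E; rewrite !inE /dag_on.
by rewrite (_ : E \subset _) ?andbT //; apply/subsetP=> e; rewrite !inE.
Qed.

End Graphs.

(** * Back to the original order of the sets *)

Lemma seq_union_take (V : finType) (m k : nat) (S : m.-tuple {set V}) :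
  k <= m -> seq_union (take k S) = \bigcup_(i < m | i < k) tnth S i.
Proof.
move=> lekm; rewrite /seq_union (big_nth set0) size_takel ?size_tuple //.
under [RHS]eq_bigr => i _ do rewrite (tnth_nth set0).
rewrite -(big_mkord (fun i => i < k) (fun i => nth set0 S i)).
rewrite (big_nat_widen 0 k m) //=.
by apply: eq_bigr => i ltik; rewrite nth_take.
Qed.

(** The suffix of [rev S] from index [i] consists of the first [n - i] sets, so the indices [i < n]
    match the values [k = n - i > 0]. *)
Lemma small_unions_rev (n : nat) (S : n.-tuple {set 'I_n.+1}) :
  @small_unions n.+1 S = small_suffixes (rev S).
Proof.
have unionE k : k <= n -> seq_union (drop (n - k) (rev S)) = \bigcup_(i < n | i < k) tnth S i.
  move=> lekn; rewrite -seq_union_take //.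
  rewrite -[X in X - k](size_tuple S) -rev_take.
  by rewrite /seq_union big_rev.
apply/forallP/small_suffixesP => [small_S i|small_S k].
  rewrite size_rev size_tuple => ltin.
  have ltk : n - i < n.+1 by rewrite ltnS leq_subr.
  have /implyP := small_S (Ordinal ltk); rewrite /= subn_gt0 => /(_ ltin).
  by rewrite -unionE ?leq_subr // subKn // ltnW.
have lekn : k <= n by rewrite -ltnS.
apply/implyP=> k0; rewrite -unionE //.
have := small_S (n - k); rewrite size_rev size_tuple subKn //; apply.
by rewrite ltn_subrL k0 (leq_trans k0).
Qed.

Theorem corollary2p2 (n : nat) (hn : 1 <= n) :
  #|[set E : digraph 'I_n | acyclic E]|
  = #|[set S : n.-1.-tuple {set 'I_n} | small_unions S]|.
Proof.
case: n hn => // n _; rewrite (@card_acyclic _ n) ?card_ord //.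
pose r (S : n.-tuple {set 'I_n.+1}) := [tuple of rev S].
have rK : involutive r by move=> S; apply: val_inj; rewrite /= revK.
rewrite -(card_preimset _ (inv_inj rK)).
by apply: eq_card => S; rewrite !inE small_unions_rev.
Qed.
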